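(* Let $q$ be a prime power, $k,d$ positive integers and $r$ a non-negative integer. If there exists a systematic $(k+r,q^k,d)_q$ error correcting code, then $$ r\ge k-\log_q\big(A_q(k,d)\big).$$
   Context: An $(n,M,d)_q$ code is a set of $M$ vectors in $\mathbb{F}_q^n$ with minimum pairwise Hamming distance $d$. A $(k+r,q^k,d)_q$ code is systematic if it has the form $\{(\mathbf{u},\mathbf{p}(\mathbf{u})):\mathbf{u}\in\mathbb{F}_q^k\}$ for some map $\mathbf{p}:\mathbb{F}_q^k\to\mathbb{F}_q^r$. $A_q(k,d)$ is the maximum number of codewords in any $q$-ary code of length $k$ in which distinct codewords are at Hamming distance at least $d$ (so $A_q(k,d)=1$ if $d>k$). *)

(* Defs.v *)
From HB Require Import structures.
From mathcomp Require Import all_boot all_order all_algebra.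
From mathcomp Require Import reals exp.

Set Implicit Arguments.
Unset Strict Implicit.
Unset Printing Implicit Defensive.

Import Order.TTheory GRing.Theory Num.Theory.
Local Open Scope ring_scope.

Definition hamming (F : finFieldType) (n : nat) (x y : 'rV[F]_n) : nat :=
  #|[set i : 'I_n | x 0 i != y 0 i]|.

Definition separated (F : finFieldType) (n d : nat) (C : {set 'rV[F]_n}) : bool :=
  [forall x in C, forall y in C, (x != y) ==> (d <= hamming x y)%N].

(* The minimum is attained, so [d] is the exact minimum distance and not merely
   a lower bound; in particular a code with fewer than two words has none. *)
Definition has_min_distance (F : finFieldType) (n : nat) (C : {set 'rV[F]_n})
    (d : nat) : Prop :=
  (exists x y, [/\ x \in C, y \in C, x != y & hamming x y = d]) /\
  separated d C.

Definition is_code (F : finFieldType) (n M d : nat) (C : {set 'rV[F]_n}) : Prop :=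
  #|C| = M /\ has_min_distance C d.

Definition systematic (F : finFieldType) (k r : nat) (C : {set 'rV[F]_(k + r)}) : Prop :=
  exists p : 'rV[F]_k -> 'rV[F]_r, C = [set row_mx u (p u) | u : 'rV[F]_k].

(* A_q(k, d) for q = #|F|; unlike in [has_min_distance], the distance [d] need
   not be attained here, so singletons always compete and the value is >= 1. *)
Definition max_code_size (F : finFieldType) (k d : nat) : nat :=
  \max_(C : {set 'rV[F]_k} | separated d C) #|C|.

Definition logb (R : realType) (b x : R) : R := ln x / ln b.

(* Main.v *)
(* Fix a check vector v.  Codewords (u, p(u)) with p(u) = v differ only in their
   first k coordinates, so the fiber of p over v is itself a code of length k
   with distance at least d.  The q^r fibers cover F_q^k, whence
   q^k <= q^r A_q(k, d); take logarithms. *)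
Require Import Defs.
From HB Require Import structures.
From mathcomp Require Import all_boot all_order all_algebra.
From mathcomp Require Import reals exp.

Set Implicit Arguments.
Unset Strict Implicit.
Unset Printing Implicit Defensive.

Import Order.TTheory GRing.Theory Num.Theory.
Local Open Scope ring_scope.

(** As a sum over coordinates, the distance can be split along the two blocks of a [row_mx]. *)
Lemma hamming_sum (F : finFieldType) (n : nat) (x y : 'rV[F]_n) :
  hamming x y = (\sum_(i < n) (x 0%R i != y 0%R i))%N.
Proof. by rewrite /hamming cardsE -sum1_card big_mkcond; apply: eq_bigr. Qed.

Lemma hammingxx (F : finFieldType) (n : nat) (x : 'rV[F]_n) : hamming x x = 0%N.
Proof. by rewrite hamming_sum big1 // => i _; rewrite eqxx. Qed.

Lemma hamming_row_mx (F : finFieldType) (m n : nat)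
    (u u' : 'rV[F]_m) (v v' : 'rV[F]_n) :
  hamming (row_mx u v) (row_mx u' v') = (hamming u u' + hamming v v')%N.
Proof.
rewrite !hamming_sum big_split_ord /=.
by congr (_ + _)%N; apply: eq_bigr => i _; rewrite ?row_mxEl ?row_mxEr.
Qed.

Lemma separated_fiber (F : finFieldType) (k r d : nat)
    (p : 'rV[F]_k -> 'rV[F]_r) (v : 'rV[F]_r) :
  separated d [set row_mx u (p u) | u : 'rV[F]_k] ->
  separated d [set u | p u == v].
Proof.
move=> /forall_inP sepC; apply/forall_inP => x; rewrite inE => /eqP px.
apply/forall_inP => y; rewrite inE => /eqP py; apply/implyP => xy.
have memC u : row_mx u (p u) \in [set row_mx u (p u) | u : 'rV[F]_k].
  exact: imset_f.
have /forall_inP sepx := sepC _ (memC x).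
have /implyP := sepx _ (memC y).
(* Both check parts equal [v] and contribute 0, so the whole distance lies between [x] and [y]. *)
rewrite hamming_row_mx px py hammingxx addn0; apply.
by apply: contraNneq xy => /eq_row_mx[->].
Qed.

Lemma systematic_card_le (F : finFieldType) (k r d : nat)
    (C : {set 'rV[F]_(k + r)}) :
  systematic C -> separated d C ->
  (#|F| ^ k <= #|F| ^ r * max_code_size F k d)%N.
Proof.
move=> [p ->] sepC.
have cardrV n : #|{: 'rV[F]_n}| = (#|F| ^ n)%N by rewrite card_mx mul1n.
(* Both sides become sums over check vectors [v]: fiber sizes on the left, the constant
   [max_code_size F k d] on the right. *)
rewrite -!cardrV -sum1_card (partition_big p xpredT) // -sum_nat_const.
apply: leq_sum => v _; rewrite sum1_card -cardsE.
exact: leq_bigmax_cond (separated_fiber v sepC).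
Qed.

Theorem corollary2 (R : realType) (F : finFieldType) (q k d r : nat)
    (hq : #|F| = q) (hk : (0 < k)%N) (hd : (0 < d)%N)
    (hC : exists C : {set 'rV[F]_(k + r)},
        is_code (q ^ k) d C /\ systematic C) :
  (r%:R : R) >= k%:R - logb q%:R (max_code_size F k d)%:R.
Proof.
have [C [[_ [_ sepC]] sysC]] := hC.
have := systematic_card_le sysC sepC; rewrite hq => le_qk.
have q_gt1 : (1 < q)%N by rewrite -hq card_finNzRing_gt1.
have qk_gt0 n : (0 < q ^ n)%N by rewrite expn_gt0 ltnW.
(* Positivity, needed for [ln], comes from the counting bound itself: the product dominates
   [q ^ k > 0], so neither factor vanishes. *)
have A_gt0 : (0 < max_code_size F k d)%N.
  by have := leq_trans (qk_gt0 k) le_qk; rewrite muln_gt0 => /andP[].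
have lnq_gt0 : 0 < ln (q%:R : R) by rewrite ln_gt0 // ltr1n.
have qR_gt0 : 0 < (q%:R : R) by rewrite ltr0n ltnW.
have AR_gt0 : 0 < ((max_code_size F k d)%:R : R) by rewrite ltr0n.
(* Multiplying by [ln q > 0] clears the division; the goal becomes [k ln q <= r ln q + ln A], with
   [A] the maximal code size, which is the logarithm of [le_qk]. *)
rewrite /logb lerBlDr -(ler_pM2r lnq_gt0) mulrDl divfK ?gt_eqF //.
rewrite !mulr_natl -!lnXn // -lnM ?posrE ?exprn_gt0 //.
rewrite ler_ln ?posrE ?mulr_gt0 ?exprn_gt0 //.
by rewrite -!natrX -natrM ler_nat.
Qed.
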